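(* Assume that $\operatorname{cov}(\mathcal{M})=\mathfrak{c}$. Then (Setting (4.c)) there is a subgroup of $\mathbb{Z}^{\mathbb{N}}$ which is Menger-bounded and Rothberger-bounded, has the Menger property and the Rothberger property, but is not Hurewicz-bounded and does not have the Hurewicz property.
   Context: $\mathfrak{c}=2^{\aleph_0}$, and $\operatorname{cov}(\mathcal{M})$ is the minimal cardinality of a cover of $\mathbb{R}$ by meager sets; equivalently, of $Y\subseteq\mathbb{N}^{\mathbb{N}}$ such that there is no $f\in\mathbb{N}^{\mathbb{N}}$ with the property that for each $y\in Y$, $f(n)=y(n)$ for some $n$. The group $\mathbb{Z}^{\mathbb{N}}$ carries pointwise addition and the product topology ($\mathbb{Z}$ discrete); subgroups carry the subspace topology. For a topological group $(G,\cdot)$, with the condition required for each sequence $(U_n)_{n\in\mathbb{N}}$ of neighborhoods of the unit: $G$ is Menger-bounded if there are finite $F_n\subseteq G$ with $G=\bigcup_n F_n\cdot U_n$; Hurewicz-bounded if there are finite $F_n\subseteq G$ such that each $g\in G$ belongs to $F_n\cdot U_n$ for all but finitely many $n$; Rothberger-bounded if there are $a_n\in G$ with $G=\bigcup_n a_n\cdot U_n$. For a topological space $X$, with the condition required for each sequence $(\mathcal{U}_n)_{n\in\mathbb{N}}$ of open covers of $X$: $X$ has the Menger property if there are finite $\mathcal{F}_n\subseteq\mathcal{U}_n$ such that $\bigcup_n\mathcal{F}_n$ covers $X$; the Hurewicz property if there are finite $\mathcal{F}_n\subseteq\mathcal{U}_n$ such that each $x\in X$ belongs to $\bigcup_{U\in\mathcal{F}_n}U$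 for all but finitely many $n$; the Rothberger property if there are $U_n\in\mathcal{U}_n$ with $X=\bigcup_n U_n$. *)

(* Defs.v *)
From HB Require Import structures.
From mathcomp Require Import all_boot all_order all_algebra.
From mathcomp Require Import all_classical all_reals all_analysis.
Import GRing.Theory.

Set Implicit Arguments.
Unset Strict Implicit.
Unset Printing Implicit Defensive.

Local Open Scope classical_set_scope.
Local Open Scope card_scope.
Local Open Scope ring_scope.

(** * Selection properties of topological spaces *)

Section selection_properties.
Variable X : topologicalType.
Implicit Types (C : set (set X)) (U F : nat -> set (set X)).

Definition open_cover C : Prop := C `<=` open /\ \bigcup_(V in C) V = [set: X].

Definition menger_property : Prop :=
  forall U, (forall n, open_cover (U n)) ->
  exists F, (forall n, finite_set (F n) /\ F n `<=` U n) /\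
    \bigcup_n \bigcup_(V in F n) V = [set: X].

Definition hurewicz_property : Prop :=
  forall U, (forall n, open_cover (U n)) ->
  exists F, (forall n, finite_set (F n) /\ F n `<=` U n) /\
    forall x : X, \forall n \near \oo, (\bigcup_(V in F n) V) x.

Definition rothberger_property : Prop :=
  forall U, (forall n, open_cover (U n)) ->
  exists V : nat -> set X, (forall n, U n (V n)) /\ \bigcup_n V n = [set: X].

End selection_properties.

(** * Boundedness properties of (abelian, additively written) topological
    groups. Neighborhoods of the unit are not required to be open. *)

Section boundedness_properties.
Variable G : topologicalZmodType.
Implicit Types U F : nat -> set G.

Definition menger_bounded : Prop :=
  forall U, (forall n, nbhs (0 : G) (U n)) ->
  exists F, (forall n, finite_set (F n)) /\
    \bigcup_n [set f + u | f in F n & u in U n] = [set: G].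

Definition hurewicz_bounded : Prop :=
  forall U, (forall n, nbhs (0 : G) (U n)) ->
  exists F, (forall n, finite_set (F n)) /\
    forall g : G, \forall n \near \oo, [set f + u | f in F n & u in U n] g.

Definition rothberger_bounded : Prop :=
  forall U, (forall n, nbhs (0 : G) (U n)) ->
  exists a : nat -> G, \bigcup_n [set a n + u | u in U n] = [set: G].

End boundedness_properties.

(** * Meager sets and their covering number *)

Section covering_number.
Variable T : topologicalType.
Implicit Types (A : set T) (C : set (set T)).

Definition nowhere_dense A : Prop := interior (closure A) = set0.

Definition meager A : Prop :=
  exists2 N : nat -> set T, (forall n, nowhere_dense (N n)) & A = \bigcup_n N n.

Definition meager_cover C : Prop :=
  C `<=` meager /\ \bigcup_(A in C) A = [set: T].

(* There being no type of cardinals, "the least cardinality of a cover by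
   meager sets is that of [K]" is expressed as a property of [K]. *)
Definition cov_meager_is (I : Type) (K : set I) : Prop :=
  (exists2 C, meager_cover C & C #= K) /\
  (forall C, meager_cover C -> K #<= C).

End covering_number.

(** * Subgroups of a topological group, with the subspace topology *)

Record subgroup_type (G : zmodType) (H : zmodClosed G) : Type :=
  Subgroup { subgroup_val : G; _ : subgroup_val \in H }.

HB.instance Definition _ (G : zmodType) (H : zmodClosed G) :=
  [isSub for @subgroup_val G H].
HB.instance Definition _ (G : zmodType) (H : zmodClosed G) :=
  [Choice of subgroup_type H by <:].
HB.instance Definition _ (G : zmodType) (H : zmodClosed G) :=
  [SubChoice_isSubZmodule of subgroup_type H by <:].

HB.instance Definition _ (G : topologicalZmodType) (H : zmodClosed G) :=
  Topological.copy (subgroup_type H)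
    (initial_topology (val : subgroup_type H -> G)).

Lemma subgroup_sub_continuous (G : topologicalZmodType) (H : zmodClosed G) :
  continuous (fun x : subgroup_type H * subgroup_type H => x.1 - x.2).
Proof.
have valc : continuous (val : subgroup_type H -> G).
  exact: initial_continuous.
apply: (@continuous_comp_initial (subgroup_type H) _ G val) => x.
have -> : val \o (fun x : subgroup_type H * subgroup_type H => x.1 - x.2) =
    (fun y : G * G => y.1 - y.2) \o
    (fun x : subgroup_type H * subgroup_type H => (val x.1, val x.2)).
  by apply/funext => y; exact: GRing.valB.
apply: continuous_comp; last exact: sub_continuous.
by apply: cvg_pair; apply: continuous_comp;
  [exact: cvg_fst|exact: valc|exact: cvg_snd|exact: valc].
Qed.

HB.instance Definition _ (G : topologicalZmodType) (H : zmodClosed G) :=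
  PreTopologicalNmodule_isTopologicalZmodule.Build (subgroup_type H)
    (@subgroup_sub_continuous G H).

(** * The group of integer sequences *)

HB.instance Definition _ := hasNbhs.Build int principal_filter.
HB.instance Definition _ := Discrete_ofNbhs.Build int erefl.
HB.instance Definition _ := DiscreteUniform_ofNbhs.Build int.

Definition int_sequences : Type := {ptws nat -> int}.

HB.instance Definition _ := GRing.Zmodule.copy int_sequences (nat -> int).
HB.instance Definition _ := Topological.copy int_sequences {ptws nat -> int}.

Lemma int_sequences_sub_continuous :
  continuous (fun x : int_sequences * int_sequences => x.1 - x.2).
Proof.
have projc n : continuous (fun x : int_sequences => x n).
  exact: (@proj_continuous nat (fun=> int) n).
move=> x; apply/(@pointwise_cvgP nat int) => n A.
rewrite !nbhs_principalE => /principal_filterP Axn.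
have eqn (y : int_sequences) : nbhs y [set z : int_sequences | z n = y n].
  by apply: (projc n y [set y n]); exact: discrete_set1.
exists ([set z : int_sequences | z n = x.1 n],
        [set z : int_sequences | z n = x.2 n]) => //.
move=> [y z] /= [yn zn].
have -> : (y - z) n = (x.1 - x.2) n; last exact: Axn.
by rewrite -[LHS]/(y n - z n) -[RHS]/(x.1 n - x.2 n) yn zn.
Qed.

HB.instance Definition _ :=
  PreTopologicalNmodule_isTopologicalZmodule.Build int_sequences
    int_sequences_sub_continuous.

(* Main.v *)
(** Since [cov(M) = c], fewer than [c] dense open subsets of a Baire space
    [A^nat] have a common point; this transfers from [R] along a map
    [R -> nat^nat] that pulls dense open sets back to sets with nowhere dense
    complement. The subgroup is generated by the eventually zero sequences and
    by points [x_w] chosen by transfinite recursion. Code each sequence of open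
    covers by a sequence [D] of sets of finite prefixes. At the stage [u] where
    [D] shows up, fewer than [c] elements have been generated, so a generic
    selection of one prefix from each [D n] captures all of them. The union [O]
    of the selected basic open sets is never revised: since the eventually zero
    sequences are dense and in the group, for each word [l] the set of [y] such
    that substituting [y] for [x_w] in [l] gives an element of [O] is dense
    open, so a generic [x_w] keeps the group generated so far inside [O]. Being
    generic, the [x_w] also escape every sequence of finite subsets of [Z]
    infinitely often, which refutes Hurewicz-boundedness. *)

From HB Require Import structures.
Require Import Defs.
From mathcomp Require Import all_boot all_order all_algebra.
From mathcomp Require Import all_classical all_reals all_analysis.
From mathcomp Require Import wochoice lra.
Import Order.TTheory GRing.Theory Num.Theory numFieldNormedType.Exports.

Set Implicit Arguments.
Unset Strict Implicit.
Unset Printing Implicit Defensive.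

Local Open Scope classical_set_scope.
Local Open Scope card_scope.
(** * From meager sets of reals to dense open sets of sequences *)

Definition agree {A : Type} (m : nat) (f g : nat -> A) : Prop :=
  forall i, (i < m)%N -> f i = g i.

(** Density and openness in the product of discrete spaces, stated through finite prefixes so that
    no topology on [A] is needed. *)
Definition dense_open {A : Type} (O : set (nat -> A)) : Prop :=
  (forall f, O f -> exists m, forall g, agree m f g -> O g) /\
  (forall f m, exists2 g, agree m f g & O g).

(** A bit sequence is read as a table through [pickle]; [column b n] is the first row with a true
    bit in column [n], and 0 if there is none. *)
Definition is_least (b : nat -> bool) (n k : nat) : Prop :=
  b (pickle (n, k)) /\ forall j, (j < k)%N -> ~~ b (pickle (n, j)).

Definition column (b : nat -> bool) (n : nat) : nat := xget 0%N (is_least b n).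

Lemma column_least b n k : is_least b n k -> column b n = k.
Proof.
move=> bk; have := xgetI 0%N bk; rewrite -/(column b n).
move: (column b n) bk => j [bk ltk] [bj ltj].
by case: (ltngtP j k) => // [/ltk|/ltj]; rewrite ?bj ?bk.
Qed.

Lemma pickle_pair_lt m : exists N, forall n k : nat,
  (pickle (n, k) < m)%N -> (n < N)%N /\ (k < N)%N.
Proof.
pose F (p : nat) :=
  if @unpickle (nat * nat)%type p is Some (n, k) then (n + k).+1 else 0%N.
exists (\max_(p < m) F p) => n k nkm.
have := leq_bigmax (F := fun p : 'I_m => F p) (Ordinal nkm).
rewrite /F /= pickleK => h.
by split; apply: leq_trans h; rewrite ltnS ?leq_addr ?leq_addl.
Qed.

(** Continuity of [column] where every column has a true bit: the value at [n] is decided by the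
    rows up to [f n]. *)
Lemma column_open b f L : (forall n, is_least b n (f n)) ->
  exists M, forall c, agree M b c -> agree L f (column c).
Proof.
move=> bf; pose G n := \max_(k < (f n).+1) (pickle (n, k : nat)).+1.
exists (\max_(n < L) G n) => c bc n nL.
apply/esym/column_least.
have bcE (k : nat) : (k <= f n)%N -> c (pickle (n, k)) = b (pickle (n, k)).
  move=> kf; apply/esym/bc.
  have := leq_bigmax (F := fun n : 'I_L => G n) (Ordinal nL).
  apply: leq_trans => /=; rewrite /G.
  exact: (leq_bigmax (F := fun k : 'I_(f n).+1 => (pickle (n, k : nat)).+1)
    (Ordinal (kf : k < (f n).+1)%N)).
have [bfn ltf] := bf n; split; first by rewrite bcE.
by move=> j jf; rewrite bcE ?ltf // ltnW.
Qed.

(* The columns [n < N], which may meet the first [m] bits, get the values [f0];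
   the other columns are free. *)
Lemma column_onto b0 m : exists N f0, forall f, agree N f0 f ->
  exists2 b, agree m b0 b & forall n, is_least b n (f n).
Proof.
have [N HN] := pickle_pair_lt m.
(* Making all later bits true puts a true bit in every column. *)
pose b1 p := if (p < m)%N then b0 p else true.
have least1 n : is_least b1 n (column b1 n).
  have ex1 : exists k : nat, b1 (pickle (n, k)).
    exists N; rewrite /b1; case: ifP => // /HN[_]; by rewrite ltnn.
  have : is_least b1 n (ex_minn ex1).
    case: ex_minnP => k bk mink; split=> // j jk.
    by apply/negP => /mink; rewrite leqNgt jk.
  by move=> h; rewrite (column_least h).
exists N, (column b1) => f ff.
pose b p := if (p < m)%N then b0 p else
  if @unpickle (nat * nat)%type p is Some (n, k) then
  if (n < N)%N then true else k == f n else true.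
exists b => [p pm|n]; first by rewrite /b pm.
case: (ltnP n N) => nN.
  have bE (k : nat) : b (pickle (n, k)) = b1 (pickle (n, k)).
    by rewrite /b /b1 pickleK nN.
  rewrite -ff //; have [h1 h2] := least1 n.
  by split=> [|j /h2]; rewrite bE.
have bE (k : nat) : b (pickle (n, k)) = (k == f n).
  rewrite /b pickleK [(n < N)%N]ltnNge nN /=; case: ifP => // /HN[].
  by rewrite ltnNge nN.
by split=> [|j jf]; rewrite bE ?eqxx // ltn_eqF.
Qed.

(** * Binary digits of real numbers *)

Section Reals.
Variable R : realType.
Implicit Types (x y : R).
Local Open Scope ring_scope.

(** The binary digit of weight [2 ^- n]; for [n = 0] it is the parity of the floor. *)
Definition bit x (n : nat) : bool := (Num.floor (x * 2 ^+ n) %% 2)%Z == 1.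

Lemma floor_half y : Num.floor (y / 2) = (Num.floor y %/ 2)%Z.
Proof.
apply: floor_def.
have := divz_eq (Num.floor y) 2; have := floor_itv y.
have := ltz_pmod (Num.floor y) (isT : 0 < 2 :> int).
have := @modz_ge0 (Num.floor y) 2 isT.
move: (Num.floor y) => k.
move: (k %/ 2)%Z (k %% 2)%Z => q r r0 r2 /andP[k1 k2] kE.
move: k1 k2; rewrite {k}kE !intrD !intrM.
have r01 : r%:~R <= 1 :> R by rewrite (ler_int R r 1) -ltzD1.
have r00 : 0 <= r%:~R :> R by rewrite (ler_int R 0 r).
move=> k1 k2; apply/andP; split; lra.
Qed.

Lemma floor_pred x n :
  Num.floor (x * 2 ^+ n) = (Num.floor (x * 2 ^+ n.+1) %/ 2)%Z.
Proof. by rewrite -floor_half exprSr mulrA mulfK. Qed.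

Lemma bit_agree x y m : Num.floor (x * 2 ^+ m) = Num.floor (y * 2 ^+ m) ->
  agree m.+1 (bit x) (bit y).
Proof.
elim: m => [|m IH] fE i; rewrite ltnS leq_eqVlt => /orP[/eqP->|//];
  rewrite /bit ?fE //.
by apply: IH; rewrite (floor_pred x m) (floor_pred y m) fE.
Qed.

(** Appending [j] digits of [b] to the integer [Num.floor (x * 2 ^+ m)] gives [k], the index of a
    dyadic subinterval. *)
Lemma bit_onto x m b : agree m.+1 (bit x) b -> forall j, exists k,
  forall y, Num.floor (y * 2 ^+ (m + j)) = k ->
    Num.floor (y * 2 ^+ m) = Num.floor (x * 2 ^+ m) /\
    agree (m + j).+1 b (bit y).
Proof.
move=> xb; elim=> [|j [k IH]].
  exists (Num.floor (x * 2 ^+ m)) => y; rewrite addn0 => yx; split=> // i im.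
  by rewrite -xb // -(bit_agree yx).
exists (k * 2 + (b (m + j.+1)%N : nat)%:Z) => y yE.
have [yx yb] : Num.floor (y * 2 ^+ m) = Num.floor (x * 2 ^+ m) /\
    agree (m + j).+1 b (bit y).
  apply: IH; rewrite (floor_pred y (m + j)) -addnS yE divzMDl //.
  rewrite divz_small ?addr0 //.
  by case: (b _).
split=> // i; rewrite ltnS leq_eqVlt => /orP[/eqP->|].
  by rewrite /bit yE modzMDl; case: (b _).
by rewrite addnS; exact: yb.
Qed.

(** The interval contains a dyadic one, which fixes a prefix [b0]; all later digits can be
    prescribed on dyadic subintervals. *)
Lemma bit_itv (a b : R) : a < b -> exists m b0, forall c, agree m b0 c ->
  forall M, exists u v, u < v /\ forall y, u < y < v ->
    a < y < b /\ agree M c (bit y).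
Proof.
move=> ab; have ba0 : 0 < b - a by rewrite subr_gt0.
have [m Hm] : exists m, 2 / (b - a) < 2 ^+ m.
  by exists (Num.bound (2 / (b - a))); exact: upper_nthrootP.
have p2 n : 0 < 2 ^+ n :> R by exact: exprn_gt0.
(* [k / 2 ^+ m] is the first dyadic point of level [m] after [a], and the choice of [m] puts the
   next one before [b]. *)
pose k := Num.floor (a * 2 ^+ m) + 1.
pose x := k%:~R / 2 ^+ m : R.
have xk : Num.floor (x * 2 ^+ m) = k.
  by rewrite /x divfK ?gt_eqF //; exact: intrKfloor.
exists m.+1, (bit x) => c xc M.
have [k' Hk'] := bit_onto xc M.
exists (k'%:~R / 2 ^+ (m + M)), ((k' + 1)%:~R / 2 ^+ (m + M)).
split; first by rewrite ltr_pM2r ?invr_gt0 // ltr_int ltrDl.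
move=> y; rewrite ltr_pdivrMr // ltr_pdivlMr // => /andP[ky yk].
have [|] := Hk' y; first by apply: floor_def; rewrite ltW.
rewrite xk => yE cy; split; last first.
  by move=> i iM; apply: cy; rewrite ltnS (leq_trans (ltnW iM)) // leq_addl.
have /andP[y1 y2] := floor_itv (y * 2 ^+ m).
have /andP[a1 a2] := floor_itv (a * 2 ^+ m).
move: y1 y2; rewrite yE /k !intrD => y1 y2; rewrite intrD in a2.
rewrite -(ltr_pM2r (p2 m) a) -(ltr_pM2r (p2 m) y).
move: Hm; rewrite ltr_pdivrMr // mulrBr => Hm; apply/andP; split; lra.
Qed.

(** Any ball contains an interval that [column] and [bit] send into [O]: the ball fixes finitely
    many bits, hence constrains finitely many columns, and density of [O] fills in the others. *)
Lemma nowhere_dense_column (O : set (nat -> nat)) : dense_open O ->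
  nowhere_dense [set x : R | ~ O (column (bit x))].
Proof.
move=> [Oopen Odense]; apply/seteqP; split=> // x.
rewrite /interior -nbhs_ballE => -[e e0 eA].
have [m [b0 Hb0]] : exists m b0, forall c, agree m b0 c ->
    forall M, exists u v, u < v /\ forall y, u < y < v ->
    x - e < y < x + e /\ agree M c (bit y).
  by apply: bit_itv; move: e0 => /= e0; lra.
have [N [f0 Hf0]] := column_onto b0 m.
have [f f0f Of] := Odense f0 N; have [L OL] := Oopen f Of.
have [b b0b bf] := Hf0 f f0f; have [M bM] := column_open L bf.
have [u [v [uv Huv]]] := Hb0 b b0b M.
have Huv' y : u < y < v -> O (column (bit y)).
  by move=> /Huv[_ by_]; apply: OL; exact: bM.
pose z := (u + v) / 2.
have zuv : u < z < v by rewrite /z; apply/andP; split; lra.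
have /eA zA : ball x e z.
  by rewrite /ball /= distrC ltr_distl; have [] := Huv z zuv.
have [y [yO yuv]] := zA _ (near_in_itvoo zuv).
by apply: yO; apply: Huv'; move: yuv; rewrite /= in_itv.
Qed.

End Reals.

(* [small A] means [#|A| < c]: cardinals are comparable. *)
Definition small {I : Type} (A : set I) : Prop := ~ ([set: nat -> bool] #<= A).

Lemma small_subset {I : Type} (A B : set I) : A `<=` B -> small B -> small A.
Proof.
by move=> AB + AT; apply; exact: card_le_trans AT (subset_card_le AB).
Qed.

Lemma dense_open_comp {A B : Type} (g : A -> B) (O : set (nat -> B)) :
  (forall b, exists a, g a = b) -> dense_open O ->
  dense_open [set f | O (g \o f)].
Proof.
move=> /choice[h hK] [Oo Od]; split=> [f /Oo[m Om]|f m].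
  by exists m => f' ff'; apply: Om => i im /=; rewrite ff'.
have [f' ff' Of'] := Od (g \o f) m.
exists (fun i => if (i < m)%N then f i else h (f' i)).
  by move=> i im; rewrite im.
rewrite /=; suff -> : g \o (fun i => if (i < m)%N then f i else h (f' i)) = f'
  by [].
by apply/funext => i /=; case: ifP => [im|_]; [rewrite -ff'|exact: hK].
Qed.

Lemma dense_open_impl {A : Type} (P : Prop) (O : set (nat -> A)) :
  (P -> dense_open O) -> dense_open [set f | P -> O f].
Proof.
move=> Od; have [p|np] := pselect P.
  have -> : [set f | P -> O f] = O; last exact: Od.
  by apply/seteqP; split=> f /=; [exact|move=> ? _].
by split=> [f _|f m]; [exists 0%N => ? _ /np|exists f => // /np].
Qed.

(** * Generic sequences for fewer than continuum many dense open sets *)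

Section Genericity.
Variables (R : realType) (covR : cov_meager_is R [set: nat -> bool]).

(** If every [column (bit x)] failed some [O i], the nowhere dense sets [N i] would cover the reals,
    and [J] would have at least continuum many elements. *)
Lemma generic_nat {I : Type} (J : set I) (O : I -> set (nat -> nat)) :
  small J -> (forall i, J i -> dense_open (O i)) ->
  exists f, forall i, J i -> O i f.
Proof.
move=> smallJ Od; apply: contrapT => /forallNP noO; apply: smallJ.
pose N i := [set x : R | ~ O i (column (bit x))].
apply: (@card_le_trans _ _ _ (N @` J)); last exact: card_image_le.
apply: (covR.2); split.
  move=> _ [i Ji <-]; exists (fun=> N i).
    by move=> _; apply: nowhere_dense_column; exact: Od.
  by apply/seteqP; split=> x; [exists 0%N|case].
apply/seteqP; split=> // x _.
have /existsNP[i /not_implyP[Ji Oix]] := noO (column (bit x)).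
by exists (N i) => //; exists i.
Qed.

Lemma generic {A : countType} (a0 : A) {I : Type} (J : set I)
    (O : I -> set (nat -> A)) :
  small J -> (forall i, J i -> dense_open (O i)) ->
  exists f, forall i, J i -> O i f.
Proof.
move=> smallJ Od; pose g n := odflt a0 (unpickle n).
have [i /Od Oi|f Hf] :=
  @generic_nat I J (fun i => [set f | O i (g \o f)]) smallJ.
  apply: dense_open_comp Oi => a; exists (pickle a); by rewrite /g pickleK.
by exists (g \o f).
Qed.

End Genericity.

(** * Words over an alphabet, and their number *)

Section Words.
Variable T : Type.
Implicit Types (A B : set T) (l : seq (nat + T)).

(** The letters [inl n] are always allowed: they will denote eventually zero sequences, and they
    serve as spare symbols in codings. *)
Fixpoint word_over A l : Prop :=
  if l is c :: l' then
    (if c is inr t then A t else True) /\ word_over A l'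
  else True.

Lemma word_over_sub A B l : A `<=` B -> word_over A l -> word_over B l.
Proof.
by move=> AB; elim: l => //= -[n|t] l IH [h /IH]; split=> //; exact: AB.
Qed.

Lemma word_over_cat A l1 l2 :
  word_over A (l1 ++ l2) <-> word_over A l1 /\ word_over A l2.
Proof. by elim: l1 => [|c l1 IH] /=; tauto. Qed.

(* Spare letters [inl n] serve as separators: [join], [before] and [after] code
   pairs of words by words. *)
Definition shift (c : nat + T) := if c is inl n then inl n.+1 else c.
Definition unshift (c : nat + T) := if c is inl n then inl n.-1 else c.

Definition join l1 l2 := map shift l1 ++ inl 0%N :: l2.

Fixpoint before l :=
  if l is c :: l' then
    if c is inl 0%N then [::] else unshift c :: before l'
  else [::].

Fixpoint after l :=
  if l is c :: l' then if c is inl 0%N then l' else after l' else [::].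

Lemma before_join l1 l2 : before (join l1 l2) = l1.
Proof. by elim: l1 => //= -[n|t] l /= IH; congr cons. Qed.

Lemma after_join l1 l2 : after (join l1 l2) = l2.
Proof. by elim: l1 => //= -[n|t] l. Qed.

Lemma word_over_join A l1 l2 :
  word_over A l1 -> word_over A l2 -> word_over A (join l1 l2).
Proof.
move=> A1 A2; apply/word_over_cat; split=> //.
by elim: l1 A1 => //= -[n|t] l IH /= [? /IH].
Qed.

(** Two nested uses of [join] code a triple by one word, which [d] decodes. *)
Lemma small_word_over3 A : small (word_over A) -> small [set l : _ * _ * _ |
  word_over A l.1.1 /\ word_over A l.1.2 /\ word_over A l.2].
Proof.
move=> + cA; apply; apply: card_le_trans cA _.
pose d l := (before l, before (after l), after (after l)).
apply: (@card_le_trans _ _ _ (d @` word_over A)); last exact: card_image_le.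
apply: subset_card_le => -[[l1 l2] l3] /= [A1 [A2 A3]].
exists (join l1 (join l2 l3)); first by do 2![apply: word_over_join => //].
by rewrite /d !(before_join, after_join).
Qed.

End Words.

(** * Transfinite recursion with a choice at each stage *)

Section Recursion.
Variables (T : Type) (X : choiceType) (x0 : X) (lt : T -> T -> Prop).

(** The requirement at [w] sees only earlier values, so these may be extended by [x0] before
    choosing; a stage without any solution also gets [x0]. *)
Lemma wf_choice (P : T -> (T -> X) -> X -> Prop) : well_founded lt ->
  (forall w e e' y, (forall v, lt v w -> e v = e' v) -> P w e y -> P w e' y) ->
  exists e, forall w, (exists y, P w e y) -> P w e (e w).
Proof.
move=> wf Pext.
pose ext w (rec : forall v, lt v w -> X) v :=
  if pselect (lt v w) is left h then rec v h else x0.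
pose F w rec := xget x0 [set y | P w (@ext w rec) y].
exists (Fix wf (fun=> X) F) => w [y Py].
set e := Fix _ _ _ in y Py *.
have ew : e w = xget x0 [set y | P w (@ext w (fun v _ => e v)) y].
  rewrite /e Fix_eq // => v f g fg; congr F.
  by apply/functional_extensionality_dep => u; apply/funext => h.
have extE v : lt v w -> ext w (fun v _ => e v) v = e v.
  by rewrite /ext; case: pselect.
rewrite ew; apply: (Pext w (ext w (fun v _ => e v))) => //.
by apply: (@xgetI _ _ _ y); apply: Pext Py => v /extE.
Qed.

End Recursion.

(** Cantor's diagonal: words over the empty set are lists of integers, hence countably many. *)
Lemma word_over_set0_not_onto (T : Type) (g : seq (nat + T) -> nat -> bool) :
  exists b, forall l, word_over set0 l -> g l <> b.
Proof.
pose h n := g (map inl (odflt [::] (unpickle n))).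
exists (fun n => ~~ h n n) => l l0 gl.
have [s ls] : exists s, l = map inl s.
  elim: l l0 {gl} => [|[n|t] l IH] /=; [by exists [::]| |by case].
  by case=> _ /IH[s ->]; exists (n :: s).
have := congr1 (@^~ (pickle s)) gl; rewrite /h pickleK /= -ls.
by case: (g l _).
Qed.

(** * Words over a well-ordered alphabet *)

Section WellOrder.
Variables (T : eqType) (le : rel T) (le_wo : well_order le).

Definition upto w : set T := [set v | le v w].
Definition below w : set T := [set v | ~~ le w v].

(** [well_order] provides unique minima of nonempty sets; this and the next three order axioms come
    from sets of at most three elements. *)
Lemma wo_refl : reflexive le.
Proof.
move=> w; have [|v [[]]] := le_wo (A := pred1 w).
  by exists w; exact: eqxx.
by rewrite inE => /eqP-> /(_ w (eqxx w)).
Qed.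

Lemma wo_total : total le.
Proof.
move=> v w; have [|u [[]]] := le_wo (A := pred2 v w).
  by exists v; rewrite inE eqxx.
rewrite !inE => /orP[]/eqP-> h _.
  by rewrite h // inE eqxx orbT.
by rewrite (h v) ?orbT // inE eqxx.
Qed.

Lemma wo_anti : antisymmetric le.
Proof.
move=> v w /andP[vw wv]; have [|x [_ x_uniq]] := le_wo (A := pred2 v w).
  by exists v; rewrite inE eqxx.
rewrite -(x_uniq v) ?(x_uniq w) //; split; rewrite ?inE ?eqxx ?orbT //;
  by move=> y; rewrite !inE => /orP[]/eqP->; rewrite ?wo_refl.
Qed.

Lemma wo_trans : transitive le.
Proof.
move=> v u w uv vw; have [|x [[]]] := le_wo (A := pred3 u v w).
  by exists u; rewrite !inE eqxx.
rewrite !inE => /or3P[]/eqP-> h _.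
- by apply: h; rewrite !inE eqxx !orbT.
- have vu : le v u by apply: h; rewrite !inE eqxx.
  by rewrite (@wo_anti u v) // uv.
have wv : le w v by apply: h; rewrite !inE eqxx orbT.
by rewrite (@wo_anti w v) // wv.
Qed.

Lemma wo_wf : well_founded (fun v w => ~~ le w v).
Proof.
move=> w; apply: contrapT => nw.
have [|v [[/asboolP nv vmin] _]] :=
    le_wo (A := [pred v | `[< ~ Acc (fun v w => ~~ le w v) v >]]).
  by exists w; apply/asboolP.
apply: nv; constructor => u vu; apply: contrapT => nu.
by move/negP: vu; apply; apply: vmin; apply/asboolP.
Qed.

Lemma below_upto w : below w `<=` upto w.
Proof. by move=> v /= /negP wv; have /orP[|] := wo_total v w. Qed.

(** A word has finitely many letters; [v] is the largest one when not all are below [u]. *)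
Lemma word_over_split (A : set T) u (l : seq (nat + T)) : word_over A l ->
  word_over (below u) l \/ exists v, [/\ A v, le u v & word_over (upto v) l].
Proof.
elim: l => [|c l IH] /=; first by left.
case: c => [n [_ /IH]|t [At /IH]].
  by case=> [?|[v [? ? ?]]]; [left|right; exists v].
case=> [lu|[v [Av uv lv]]].
  have [tu|ut] := boolP (~~ le u t); first by left.
  right; exists t; split=> //=; first by rewrite -[le _ _]negbK.
  split; first exact: wo_refl.
  apply: word_over_sub lu => s /below_upto su; apply: wo_trans su _.
  by rewrite -[le _ _]negbK.
right; have /orP[tv|vt] := wo_total t v; first by exists v.
exists t; split=> //; first exact: wo_trans uv vt.
split; first exact: wo_refl.
by apply: word_over_sub lv => s /= sv; exact: wo_trans vt.
Qed.

End WellOrder.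

Lemma card_le_word_over (T : Type) : [set: T] #<= word_over [set: T].
Proof.
pose d (l : seq (nat + T)) := if l is [:: inr t] then Some t else None.
rewrite -card_ge_some.
apply: (@card_le_trans _ _ _ (d @` word_over [set: T])).
2: exact: card_image_le.
by apply: subset_card_le => _ [t _ <-]; exists [:: inr t].
Qed.

(** The spare letter [inl 0] stands for [t], and the other spare letters move up by one. *)
Lemma word_over_setU1 (T : Type) (A : set T) t :
  word_over (A `|` [set t]) #<= word_over A.
Proof.
pose d (c : nat + T) := if c is inl 0%N then inr t else unshift c.
apply: (@card_le_trans _ _ _ (map d @` word_over A)); last exact: card_image_le.
apply: subset_card_le; elim=> [|c l IH] /=; first by exists [::].
move=> [cA /IH[l' Al' <-]].
have [c' c'A <-] : exists2 c', (if c' is inr s then A s else True) & d c' = c.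
  case: c cA => [n _|s [As|->]]; first by exists (inl n.+1).
    by exists (inr s).
  by exists (inl 0%N).
by exists (c' :: l').
Qed.

(* Taking the words over the set [K] of all [w] such that there are few words
   over [upto le w] avoids the cardinal arithmetic [k * k = k] that an initial
   ordinal would require. *)
Lemma exists_tower : exists2 le : rel (nat -> bool), well_order le &
  [set: nat -> bool] #<=
    word_over [set w | small (word_over (upto le w))].
Proof.
have [le le_wo] := @well_ordering_principle (nat -> bool : eqType).
exists le => //.
have [all_small|/existsNP[w0 nw0]] :=
  pselect (forall w, small (word_over (upto le w))).
  have -> : [set w | small (word_over (upto le w))] = setT
    by apply/seteqP; split=> w //= _; exact: all_small.
  exact: card_le_word_over.
(* For the least [w] with many words over [upto le w], every earlier element has few, so [upto le w]
   adds at most [w] to the alphabet. *)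
have [|w [[/asboolP nw wmin] _]] :=
    le_wo [pred v | `[< ~ small (word_over (upto le v)) >]].
  by exists w0; apply/asboolP.
apply: card_le_trans (contrapT nw) _.
apply: (card_le_trans _ (word_over_setU1 _ w)); apply: subset_card_le.
move=> l; apply: word_over_sub => v vw.
have [->|nvw] := eqVneq v w; [by right|left].
apply: contrapT => /asboolP /wmin wv.
by move/eqP: nvw; apply; apply: (wo_anti le_wo); apply/andP.
Qed.

(** * The transfinite construction *)

Definition prefix_covers (D : nat -> set (seq int)) (h : nat -> int) : Prop :=
  forall n, exists k, D n (mkseq h k).

(** A Rothberger selection in terms of prefixes; [f n] has to lie in [D n] only at an index where it
    captures [h]. *)
Definition captured (D : nat -> set (seq int)) (f : nat -> seq int)
    (h : nat -> int) : Prop :=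
  exists n k, D n (mkseq h k) /\ f n = mkseq h k.

Lemma eq_mkseq_agree (h h' : nat -> int) k :
  agree k h h' -> mkseq h k = mkseq h' k.
Proof.
move=> hh; apply/eq_in_map => i; rewrite mem_iota add0n => /andP[_]; exact: hh.
Qed.

Lemma captured_open D f h : captured D f h ->
  exists m, forall h', agree m h h' -> captured D f h'.
Proof.
by move=> [n [k [Dn fn]]]; exists k => h' /eq_mkseq_agree hh;
  exists n, k; rewrite -hh.
Qed.

(** Whatever the first [m] selections are, the next one can be a prefix of [h] from [D m]. *)
Lemma captured_dense_open D h : prefix_covers D h ->
  dense_open [set f | captured D f h].
Proof.
move=> Dh; split=> [f [n [k [Dn fn]]]|f m].
  by exists n.+1 => g fg; exists n, k; rewrite -fg.
have [k Dk] := Dh m.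
exists (fun i => if i == m then mkseq h k else f i).
  by move=> i im; rewrite ltn_eqF.
by exists m, k; rewrite eqxx.
Qed.

(** * Group elements as values of words *)

Section Values.
Local Open Scope ring_scope.
Variable T : eqType.
Implicit Types (e : T -> nat -> int) (l : seq (nat + T)).

Definition fin_seq (n : nat) : nat -> int :=
  nth 0 (odflt [::] (unpickle n)).

Lemma fin_seq_dense (h : nat -> int) m : exists n, agree m h (fin_seq n).
Proof.
exists (pickle (mkseq h m)) => i im.
by rewrite /fin_seq pickleK /= nth_mkseq.
Qed.

Lemma fin_seq0 i : fin_seq (pickle ([::] : seq int)) i = 0.
Proof. by rewrite /fin_seq pickleK nth_nil. Qed.

(* Subtracting the value of the rest of the word makes words closed under
   inverses without negative letters. *)
Fixpoint value e l : nat -> int :=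
  if l is c :: l' then
    (fun i => (if c is inr t then e t i else
               if c is inl n then fin_seq n i else 0) - value e l' i)
  else fun=> 0.

Lemma value_sub A e l1 l2 : word_over A l1 -> word_over A l2 ->
  exists2 l, word_over A l &
  value e l = fun i => value e l1 i - value e l2 i.
Proof.
move=> A1 A2.
(* Sums and differences go by a joint induction, because prepending a letter to a word exchanges
   them. *)
suff [] : (exists2 l, word_over A l &
      value e l = fun i => value e l1 i - value e l2 i) /\
    (exists2 l, word_over A l &
      value e l = fun i => value e l1 i + value e l2 i) by [].
elim: l1 A1 => [_|c l1 IH [cA /IH[[l Al lE] [l' Al' l'E]]]].
  split; [exists (inl (pickle ([::] : seq int)) :: l2)|exists l2] => //=;
    apply/funext => i; by rewrite ?fin_seq0 ?add0r.
split; [exists (c :: l')|exists (c :: l)] => //=; apply/funext => i.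
  by rewrite l'E opprD addrA.
by rewrite lE opprB addrA addrAC.
Qed.

Lemma eq_value A e e' l : (forall t, A t -> e t = e' t) -> word_over A l ->
  value e l = value e' l.
Proof.
move=> ee; elim: l => //= c l IH [cA /IH->].
by apply/funext => i; case: c cA => // t /ee->.
Qed.

Lemma value_agree e e' l m : (forall t, agree m (e t) (e' t)) ->
  agree m (value e l) (value e' l).
Proof.
move=> ee; elim: l => //= c l IH i im; rewrite IH //.
by case: c => // t; rewrite ee.
Qed.

Definition upd e t (y : nat -> int) : T -> nat -> int :=
  fun s => if s == t then y else e s.

Lemma upd_id e t : upd e t (e t) = e.
Proof. by apply/funext => s; rewrite /upd; case: eqP => // ->. Qed.

(** Giving [t] an eventually zero value lets [inl n] replace the letter [t], so the value already
    belongs to the group generated without [t]. *)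
Lemma value_upd_fin (A B : set T) e t n l :
  (forall s, A s -> s != t -> B s) -> word_over A l ->
  exists2 l', word_over B l' & value (upd e t (fin_seq n)) l = value e l'.
Proof.
move=> AB; elim: l => [_|c l IH [cA /IH[l' Bl' lE]]]; first by exists [::].
case: c cA => [k _|s As]; first by exists (inl k :: l') => //=; rewrite lE.
have [st|st] := eqVneq s t.
  by exists (inl n :: l') => //=; rewrite lE /upd st eqxx.
exists (inr s :: l'); first by split=> //; exact: AB.
by rewrite /= lE /upd (negbTE st).
Qed.

End Values.

(** * The choice of the generators *)

Section Construction.
Variables (R : realType) (covR : cov_meager_is R [set: nat -> bool]).

Let code := nat -> bool.

Let family (c : code) (n : nat) : set (seq int) := [set s | c (pickle (n, s))].

Let familyE D : exists c, family c = D.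
Proof.
exists (fun p => if @unpickle (nat * seq int)%type p is Some (n, s)
                 then `[< D n s >] else false).
apply/funext => n; apply/seteqP; split=> s; rewrite /family /= pickleK.
  by move/asboolP.
by move=> h; apply/asboolP.
Qed.

Variables (le : rel code) (le_wo : well_order le).

Let K : set code := [set w | small (word_over (upto le w))].

(** The bookkeeping: words over [K] name all codes, and a name over [upto le u] is dealt with from
    stage [u] on. *)
Variable (g : seq (nat + code) -> code).
Hypothesis g_onto : forall c, exists2 l, word_over K l & g l = c.

Local Notation env := (code -> nat -> int).

Let selection (e : env) D u : nat -> seq int :=
  xget (fun=> [::])
    [set f | forall l, word_over (below le u) l -> captured D f (value e l)].

(** The open set fixed at stage [u] for the family named by [r]: the union of the selected basic
    open sets. *)
Let guessed e r u h := captured (family (g r)) (selection e (family (g r)) u) h.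

(* Tuples [(r, u, l)] and [(r, m)] range over words on [upto le w], so there are
   few requirements at stage [w]. *)
Let good w (e : env) (y : nat -> int) : Prop :=
  (forall r u l, le u w -> word_over (upto le u) r -> word_over (upto le w) l ->
     (forall l', word_over (below le w) l' -> guessed e r u (value e l')) ->
     guessed e r u (value (upd e w y) l)) /\
  (forall r m, word_over (upto le w) r ->
     (forall n, exists k, ~ family (g r) n [:: k]) ->
     exists2 n, (m <= n)%N & ~ family (g r) n [:: y n]).

(** The selection at stage [u] depends on [e] only below [u], hence below [w]; this is the locality
    that the recursion requires. *)
Let guessed_ext w u e e' r : le u w -> (forall v, below le w v -> e v = e' v) ->
  guessed e r u = guessed e' r u.
Proof.
move=> uw ee; apply/funext => h; rewrite /guessed; congr (captured _ _ _).
rewrite /selection; congr xget; apply/funext => f; apply/propext.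
have eqv l : word_over (below le u) l -> value e l = value e' l.
  apply: eq_value => t tu; apply: ee; move: tu; apply: contra => wt.
  exact: wo_trans uw wt.
by split=> H l lu; have := H l lu; rewrite eqv.
Qed.

Let good_ext w e e' y : (forall v, below le w v -> e v = e' v) ->
  good w e y -> good w e' y.
Proof.
move=> ee [H1 H2]; split=> // r u l uw ru lw Hl.
rewrite -(guessed_ext r uw ee).
have -> : value (upd e' w y) l = value (upd e w y) l.
  apply: eq_value lw => t tw; rewrite /upd; case: eqP => // tw'; rewrite ee //.
  by apply/negP => wt; apply: tw'; apply: (wo_anti le_wo); apply/andP.
apply: H1 => // l' lw'; rewrite (guessed_ext r uw ee) (eq_value ee) //.
exact: Hl.
Qed.

(** Open, since a prefix of the value depends on a prefix of [y]; dense, since an eventually zero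
    [y] turns [l] into a word below [w], whose value is guessed already. *)
Let guess_dense_open w e r u l : word_over (upto le w) l ->
  (forall l', word_over (below le w) l' -> guessed e r u (value e l')) ->
  dense_open [set y | guessed e r u (value (upd e w y) l)].
Proof.
move=> lw Hl; split=> [y /captured_open[m Hm]|y m].
  exists m => y' yy'; apply: Hm; apply: value_agree => t.
  by rewrite /upd; case: eqP.
have [n yn] := fin_seq_dense y m; exists (fin_seq n) => //=.
have [|l' lw' ->] := @value_upd_fin _ _ (below le w) e w n l _ lw.
2: exact: Hl.
move=> s sw; apply: contra => ws; apply/eqP; apply: (wo_anti le_wo).
exact/andP.
Qed.

(** Sets of integers are coded as prefixes of length one, so the same codes serve for capturing and
    escaping. Coordinate [maxn m p] is late enough and still free. *)
Let escape_dense_open (D : nat -> set (seq int)) m :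
  (forall n, exists k, ~ D n [:: k]) ->
  dense_open [set y : nat -> int | exists2 n, (m <= n)%N & ~ D n [:: y n]].
Proof.
move=> Dk; split=> [y [n mn Dn]|y p].
  by exists n.+1 => y' yy'; exists n; rewrite -?yy'.
have [k nk] := Dk (maxn m p).
exists (fun i => if i == maxn m p then k else y i).
  by move=> i ip; rewrite ltn_eqF // leq_max ip orbT.
by exists (maxn m p); rewrite ?leq_maxl ?eqxx.
Qed.

Let good_exists w e : K w -> exists y, good w e y.
Proof.
move=> /small_word_over3 smallw.
(* The middle word is a tag: [[:: inr u]] for the guess made at [u], [[:: inl m]] for an escape from
   [m] on; other tags impose nothing. *)
pose O (j : seq (nat + code) * seq (nat + code) * seq (nat + code)) :
    set (nat -> int) := let: (r, s, l) := j in
  match s with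
  | [:: inr u] => [set y | le u w /\ word_over (upto le u) r /\
      (forall l', word_over (below le w) l' -> guessed e r u (value e l')) ->
      guessed e r u (value (upd e w y) l)]
  | [:: inl m] => [set y | (forall n, exists k, ~ family (g r) n [:: k]) ->
     exists2 n, (m <= n)%N & ~ family (g r) n [:: y n]]
  | _ => setT
  end.
have denseT : dense_open [set: nat -> int].
  by split=> [f _|f m]; [exists 0%N|exists f].
have [[[r s] l] /= [rw [sw lw]]|y Hy] := generic covR 0%R (O := O) smallw.
  case: s sw => [|[m|u] [|? ?]] //= _.
    by apply: dense_open_impl; exact: escape_dense_open.
  by apply: dense_open_impl => -[_ [_ Hl]]; exact: guess_dense_open.
exists y; split=> [r u l uw ru lw Hl|r m rw Dk].
  have := Hy (r, [:: inr u], l); apply=> //=; split=> //.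
  by apply: word_over_sub ru => t tu; exact: wo_trans tu uw.
by have := Hy (r, [:: inl m], [::]); apply.
Qed.

Let K_down v w : le v w -> K w -> K v.
Proof.
move=> vw; apply: small_subset => l; apply: word_over_sub => u uv.
exact: wo_trans uv vw.
Qed.

(** Otherwise countably many words would name all codes. *)
Let K_nonempty : exists w, K w.
Proof.
apply: contrapT => /forallNP K0; have [b Hb] := word_over_set0_not_onto g.
have [l lK] := g_onto b; apply: Hb; apply: word_over_sub lK => t /K0[].
Qed.

Let word_over_bounded l :
  word_over K l -> exists2 u, K u & word_over (upto le u) l.
Proof.
have [w Kw] := K_nonempty.
move=> /(word_over_split le_wo w)[lw|[v [Kv _ lv]]]; last by exists v.
by exists w => //; apply: word_over_sub lw; exact: below_upto.
Qed.

Lemma exists_generic_group : exists H : set (nat -> int),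
  [/\ H (fun=> 0%R),
      forall h h', H h -> H h' -> H (fun i => (h i - h' i)%R),
      forall D, (forall h, H h -> prefix_covers D h) ->
        exists f, forall h, H h -> captured D f h &
      forall F : nat -> set int, (forall n, exists k, ~ F n k) ->
        exists2 h, H h & forall m, exists2 n, (m <= n)%N & ~ F n (h n)].
Proof.
have [e He] := wf_choice (fun=> 0%R) (wo_wf le_wo) good_ext.
have {}He w : K w -> good w e (e w) by move=> /(good_exists e)/He.
exists (value e @` word_over K); split=> [|_ _ [l lK <-] [l' lK' <-]|D DK|F FK].
- by exists [::].
- by have [l1 l1K <-] := value_sub e lK lK'; exists l1.
- have [c cD] := familyE D; have [r rK rc] := g_onto c.
  have [u Ku ru] := word_over_bounded rK.
  exists (selection e (family (g r)) u) => _ [l lK <-].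
  rewrite -cD -rc -/(guessed e r u (value e l)).
  (* As [u] is in [K], few elements come before stage [u], so a generic selection exists and
     [selection] is not its default. *)
  have below_guessed l' : word_over (below le u) l' ->
      guessed e r u (value e l').
    have [|f Hf] := generic covR [::] (J := word_over (below le u))
      (O := fun l => [set f | captured (family (g r)) f (value e l)])
      (small_subset (fun l => word_over_sub (below_upto le_wo (w := u))) Ku).
      move=> l1 l1u; apply: captured_dense_open; rewrite rc cD; apply: DK.
      exists l1 => //; apply: word_over_sub l1u => v /(below_upto le_wo) vu.
      exact: K_down Ku.
    exact: (@xgetI _ _ [set f | forall l, word_over (below le u) l ->
      captured (family (g r)) f (value e l)] f Hf).
  (* A word reaching [u] or beyond is handled at the stage [v] of its largest letter, where [e v] is
     [good]. *)
  have step (A : set code) l' : (forall v, A v -> le u v -> K v /\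
      forall l, word_over (below le v) l -> guessed e r u (value e l)) ->
      word_over A l' -> guessed e r u (value e l').
    move=> HA /(word_over_split le_wo u)[/below_guessed//|[v [Av uv lv]]].
    have [Kv Hv] := HA v Av uv.
    by have := (He v Kv).1 r u l' uv ru lv Hv; rewrite upd_id.
  apply: (step K) => // v Kv uv; split=> //.
  (* By induction on [v], everything generated before stage [v] stays inside the guessed open
     set. *)
  elim/(well_founded_ind (wo_wf le_wo)): v Kv {uv} => v IH Kv l'.
  apply: step => w wv _; have Kw : K w by apply: K_down Kv; exact: below_upto.
  by split=> //; exact: IH.
- have [c cF] := familyE (fun n => [set s | exists2 k, F n k & s = [:: k]]).
  have [r rK rc] := g_onto c; have [w Kw rw] := word_over_bounded rK.
  exists (e w).
    exists [:: inr w; inl (pickle ([::] : seq int))] => //=.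
    by apply/funext => i; rewrite fin_seq0 !subr0.
  move=> m; have [n|n mn Fn] := (He w Kw).2 r m rw.
    by have [k nk] := FK n; exists k; rewrite rc cF => -[j Fj [kj]]; apply: nk;
      rewrite kj.
  by exists n => // Fen; apply: Fn; rewrite rc cF /=; exists (e w n).
Qed.

End Construction.

(** * From prefixes to covers *)

Section Topology.
Local Open Scope ring_scope.

(** The filter generated by the prefixes of [h] converges to [h] coordinatewise, hence in the
    product topology. *)
Lemma nbhs_agree (h : int_sequences) (B : set int_sequences) : nbhs h B ->
  exists m, forall h' : int_sequences, agree m h h' -> B h'.
Proof.
pose F : set_system int_sequences :=
  filter_from setT (fun m => [set h' : int_sequences | agree m h h']).
have FF : Filter F.
  apply: filter_from_filter; first by exists 0%N.
  move=> i j _ _; exists (maxn i j) => // h' hh.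
  by split=> k kij; apply: hh; rewrite leq_max kij ?orbT.
have Fh : F --> h.
  apply/(@pointwise_cvgP nat int) => n A.
  rewrite nbhs_principalE => /principal_filterP An.
  by exists n.+1 => // h' /= hh; rewrite -hh.
by move=> /Fh[m _ mB]; exists m.
Qed.

Lemma coord_open (n : nat) (k : int) : open [set h : int_sequences | h n = k].
Proof.
have projc : continuous (fun h : int_sequences => h n).
  exact: (@proj_continuous nat (fun=> int) n).
by apply: (open_comp (D := [set k]) (fun h _ => projc h)); exact: discrete_open.
Qed.

Lemma finite_int_avoid (A : set int) : finite_set A -> exists k, ~ A k.
Proof.
move=> Afin; apply: contrapT => /forallNP AT; apply: infinite_nat.
apply: (@sub_finite_set _ _ (absz @` A)); last exact: finite_image.
by move=> n _; exists n%:Z => //; apply: contrapT; exact: AT.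
Qed.

Lemma nbhs_translate (G : topologicalZmodType) (x : G) (U : set G) :
  nbhs (0 : G) U -> nbhs x [set x + u | u in U].
Proof.
move=> U0; have /= := @sub_continuous G (x, x) U; rewrite subrr => /(_ U0).
move=> [[B1 B2] /= [B1x B2x] BU]; apply: filterS B1x => y B1y.
exists (y - x); last by rewrite addrC subrK.
by apply: (BU (y, x)); split=> //; exact: nbhs_singleton.
Qed.

Variable H : zmodClosed int_sequences.
Local Notation G := (subgroup_type H).

Hypothesis H_selects : forall D : nat -> set (seq int),
  (forall h : int_sequences, h \in H -> prefix_covers D h) ->
  exists f, forall h : int_sequences, h \in H -> captured D f h.

Hypothesis H_escapes : forall F : nat -> set int,
  (forall n, exists k, ~ F n k) ->
  exists2 h : int_sequences, h \in H &
    forall m, exists2 n, (m <= n)%N & ~ F n (h n).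

Let starts_with (s : seq int) : set G :=
  [set x | exists k, mkseq (val x : int_sequences) k = s].

Let starts_with_agree (x y : G) m :
  starts_with (mkseq (val x : int_sequences) m) y ->
  agree m (val x : int_sequences) (val y : int_sequences).
Proof.
move=> [k xy] i im; have km : k = m.
  by have := congr1 size xy; rewrite !size_mkseq.
by have := congr1 (nth 0 ^~ i) xy; rewrite km !nth_mkseq.
Qed.

Let nbhs_starts_with (x : G) (B : set G) : nbhs x B ->
  exists m, starts_with (mkseq (val x : int_sequences) m) `<=` B.
Proof.
rewrite nbhsE => -[V [[W Wo <-] Wx] WB].
have [m Hm] := nbhs_agree (open_nbhs_nbhs (conj Wo Wx)).
by exists m => y /starts_with_agree/Hm; exact: WB.
Qed.

(** Common core of the two Rothberger statements: [D n] collects the prefixes whose basic open set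
    lies in a member of [P n]. Members need only be neighborhoods, since translates of [U n] may
    fail to be open. *)
Let select_sets (P : nat -> set (set G)) :
  (forall n (x : G), exists2 V, P n V & nbhs x V) ->
  exists V : nat -> set G, (forall n, P n (V n)) /\ \bigcup_n V n = setT.
Proof.
move=> PG; pose D n s := exists2 V, P n V & starts_with s `<=` V.
have [h hH n|f Hf] := H_selects (D := D).
  have [V PV /nbhs_starts_with[m mV]] := PG n (Subgroup hH).
  by exists m, V.
have /choice[V HV] n :
    exists V, P n V /\ (D n (f n) -> starts_with (f n) `<=` V).
  have [[V PV fV]|nD] := pselect (D n (f n)); first by exists V.
  (* Where [f n] is not in [D n], any member of [P n] will do. *)
  by have [V PV _] := PG n 0; exists V; split=> // /nD.
exists V; split=> [n|]; first exact: (HV n).1.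
apply/seteqP; split=> // -[h hH] _.
have [n [k [Dn fn]]] := Hf h hH.
exists n => //; apply: (HV n).2; first by rewrite fn.
by exists k; rewrite fn.
Qed.

Lemma rothberger_of_selects : rothberger_property G.
Proof.
move=> U Ucov; apply: select_sets => n x.
have [Uo UT] := Ucov n.
have [V UV Vx] : (\bigcup_(V in U n) V) x by rewrite UT.
by exists V => //; apply: open_nbhs_nbhs; split=> //; exact: Uo.
Qed.

Lemma rothberger_bounded_of_selects : rothberger_bounded G.
Proof.
move=> U U0.
have [n x|V [HV VT]] := select_sets
  (P := fun n => [set V | exists a : G, V = [set a + u | u in U n]]).
  exists [set x + u | u in U n]; first by exists x.
  exact: nbhs_translate.
have [a Va] := choice HV; exists a; rewrite -VT.
by apply: eq_bigcupr => n _; rewrite Va.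
Qed.

(** With [U n] the sequences vanishing at [n], the set [F n + U n] allows only finitely many values
    at coordinate [n]. *)
Lemma not_hurewicz_bounded_of_escapes : ~ hurewicz_bounded G.
Proof.
move=> hur.
have [n|F [Ffin FG]] :=
  hur (fun n => [set x : G | (val x : int_sequences) n = 0]).
  apply: open_nbhs_nbhs; split; last by [].
  by exists [set h : int_sequences | h n = 0] => //; exact: coord_open.
have [n|h hH Hh] := H_escapes
  (F := fun n => [set (val f : int_sequences) n | f in F n]).
  by apply: finite_int_avoid; exact: finite_image.
have [N _ HN] := FG (Subgroup hH); have [n Nn] := Hh N; apply.
have [f Fnf [u u0 fu]] := HN n Nn; exists f => //.
have -> : h = val (f + u) :> int_sequences by rewrite fu.
by rewrite GRing.valD -[RHS]/(val f n + val u n) u0 addr0.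
Qed.

Lemma not_hurewicz_of_escapes : ~ hurewicz_property G.
Proof.
move=> hur.
have [n|F [FU FG]] := hur
  (fun n => [set [set x : G | (val x : int_sequences) n = k] | k in setT]).
  split.
    move=> _ [k _ <-]; exists [set h : int_sequences | h n = k] => //.
    exact: coord_open.
  apply/seteqP; split=> // x _.
  pose k := (val x : int_sequences) n.
  by exists [set y : G | (val y : int_sequences) n = k] => //; exists k.
(* Each [V] in [F n] fixes coordinate [n]; its value is read off at a chosen point of [V], or at 0
   if [V] is empty. *)
have [n|h hH Hh] := H_escapes
  (F := fun n => [set (val (xget (0 : G) V) : int_sequences) n | V in F n]).
  by apply: finite_int_avoid; apply: finite_image; exact: (FU n).1.
have [N _ HN] := FG (Subgroup hH); have [n Nn] := Hh N; apply.
have [V FV Vh] := HN n Nn; exists V => //.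
have [k _ Vk] := (FU n).2 V FV; have := xgetI 0 Vh.
by move: Vh; rewrite -Vk /= => ->.
Qed.

End Topology.

(** * From Rothberger to Menger *)

Section Implications.

Lemma rothberger_menger (X : topologicalType) :
  rothberger_property X -> menger_property X.
Proof.
move=> roth U /roth[V [UV VT]]; exists (fun n => [set V n]); split.
  by move=> n; split=> [|_ ->]; [exact: finite_set1|].
by rewrite -VT; apply: eq_bigcupr => n _; rewrite bigcup_set1.
Qed.

Lemma rothberger_menger_bounded (G : topologicalZmodType) :
  rothberger_bounded G -> menger_bounded G.
Proof.
move=> roth U /roth[a aT]; exists (fun n => [set a n]); split.
  by move=> n; exact: finite_set1.
rewrite -aT; apply: eq_bigcupr => n _; apply/seteqP; split.
  by move=> _ [_ -> [u Uu <-]]; exists u.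
by move=> _ [u Uu <-]; exists (a n) => //; exists u.
Qed.

End Implications.

Theorem theorem9p5 (R : realType)
    (cov_meager_eq_continuum : cov_meager_is R [set: nat -> bool]) :
  exists H : zmodClosed int_sequences,
    (menger_bounded (subgroup_type H) /\ rothberger_bounded (subgroup_type H)) /\
    (menger_property (subgroup_type H) /\ rothberger_property (subgroup_type H)) /\
    ~ hurewicz_bounded (subgroup_type H) /\
    ~ hurewicz_property (subgroup_type H).
Proof.
have [le le_wo leK] := exists_tower.
(* The words over [K] are numerous enough to name every code. *)
have [g g_onto] := pcard_surjP leK.
have [S [S0 SB Ssel Sesc]] := exists_generic_group cov_meager_eq_continuum le_wo
  (fun c => g_onto c I).
pose p : {pred int_sequences} := fun h => `[< S h >].
have pB : zmod_closed p.
  split; first by apply/asboolP; exact: S0.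
  by move=> h h' /asboolP Sh /asboolP Sh'; apply/asboolP; exact: SB.
pose pZ := GRing.isZmodClosed.Build int_sequences p pB.
pose H : zmodClosed int_sequences := HB.pack p pZ.
have Hsel (D : nat -> set (seq int)) :
    (forall h : int_sequences, h \in H -> prefix_covers D h) ->
    exists f, forall h : int_sequences, h \in H -> captured D f h.
  move=> HD; have [|f Hf] := Ssel D; first by move=> h /asboolP/HD.
  by exists f => h /asboolP/Hf.
have Hesc (F : nat -> set int) : (forall n, exists k, ~ F n k) ->
    exists2 h : int_sequences, h \in H &
      forall m, exists2 n, (m <= n)%N & ~ F n (h n).
  by move=> /Sesc[h Sh Hh]; exists h => //; apply/asboolP.
exists H; split; [split|split; [split|split]].
- exact/rothberger_menger_bounded/rothberger_bounded_of_selects.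
- exact: rothberger_bounded_of_selects.
- exact/rothberger_menger/rothberger_of_selects.
- exact: rothberger_of_selects.
- exact: not_hurewicz_bounded_of_escapes.
- exact: not_hurewicz_of_escapes.
Qed.
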